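(* Let $\mathcal{A}$ be a non-empty finite alphabet. Every Champernowne word over $\mathcal{A}$ is strongly modulo-recurrent.
   Context: For a finite alphabet $\mathcal{A}$, $\mathcal{A}^*$ is the free monoid of finite words over $\mathcal{A}$ and $|v|$ is the length of $v\in\mathcal{A}^*$. An infinite word is a sequence $u=u_0u_1u_2\cdots$ of letters indexed by $\mathbb{N}=\{0,1,2,\dots\}$. A factor of $u$ of length $n$ is a word $u_ku_{k+1}\cdots u_{k+n-1}$ with $k\ge 0$. A Champernowne word over $\mathcal{A}$ is an infinite word of the form $u=w_0w_1w_2w_3\cdots$ obtained by concatenating all words of $\mathcal{A}^*$ in the order of some enumeration $\mathcal{A}^*=\{w_0,w_1,w_2,\dots\}$. An infinite word $u$ is modulo-recurrent if for every factor $w$ of $u$, every $k\ge 1$ and every $i\in\{0,1,\dots,k-1\}$ there is $l\in\mathbb{N}$ such that $w=u_{kl+i}u_{kl+i+1}\cdots u_{kl+i+|w|-1}$. An infinite word $u$ over $\mathcal{A}$ is strongly modulo-recurrent if, for every monoid morphism $\sigma:\mathcal{A}^*\to\mathcal{A}^*$ such that $\gcd(|\sigma(a)|,|\sigma(b)|)=1$ for all $a,b\in\mathcal{A}$ with $a\ne b$, and such that $\sigma(u)=\sigma(u_0)\sigma(u_1)\sigma(u_2)\cdots$ is an infinite word, the word $\sigma(u)$ is modulo-recurrent. *)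

(* Defs.v *)
From mathcomp Require Import all_boot.

Set Implicit Arguments.
Unset Strict Implicit.
Unset Printing Implicit Defensive.

Section InfiniteWords.

Variable A : Type.

Implicit Types (w : seq A) (u v : nat -> A).

Definition factor_at u (k n : nat) : seq A := mkseq (fun j => u (k + j)) n.

Definition factor w u : Prop := exists k : nat, w = factor_at u k (size w).

(* The concatenation x_0 x_1 x_2 ... is infinite and equal to v. Blocks may be
   empty; without the second conjunct the concatenation could be finite, and v
   would be any infinite word extending it. *)
Definition concat_word (x : nat -> seq A) v : Prop :=
  (forall n, let p := flatten (mkseq x n) in p = factor_at v 0 (size p)) /\
  (forall N, exists n, N <= size (flatten (mkseq x n))).

Definition champernowne u : Prop :=
  exists2 x : nat -> seq A, bijective x & concat_word x u.

Definition modulo_recurrent u : Prop :=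
  forall w, factor w u ->
  forall k i : nat, 1 <= k -> i < k ->
  exists l : nat, w = factor_at u (k * l + i) (size w).

Definition word_morphism (sigma : seq A -> seq A) : Prop :=
  sigma [::] = [::] /\ {morph sigma : s t / s ++ t}.

(* Erasing morphisms are allowed: since gcd(0, n) = n, the coprimality condition
   lets some letter be sent to the empty word. *)
Definition strongly_modulo_recurrent u : Prop :=
  forall sigma : seq A -> seq A,
  word_morphism sigma ->
  (forall a b : A, a <> b -> coprime (size (sigma [:: a])) (size (sigma [:: b]))) ->
  forall v, concat_word (fun n => sigma [:: u n]) v ->
  modulo_recurrent v.

End InfiniteWords.

(* Main.v *)
(** Every word is a block of a Champernowne word [u], hence a factor of [u].
    Let [w] be a factor of [sigma(u)] and choose a prefix [s] of [u] such that
    [sigma(s)] contains [w].  If there are two letters, their images have coprime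
    lengths, so some word [r] satisfies [|sigma(s r)| = 1] modulo [k].  Then
    consecutive occurrences of [w] in [sigma((s r)^k)], which is a factor of
    [sigma(u)], are at positions increasing by 1 modulo [k], so all residues
    modulo [k] are attained. *)
Require Import Defs.
From mathcomp Require Import all_boot.

Lemma factor_atE {A : Type} (u : nat -> A) k n :
  factor_at u k n = map u (iota k n).
Proof. by rewrite /factor_at /mkseq -{2}[k]addn0 iotaDl -map_comp. Qed.

Lemma factor_atD {A : Type} (u : nat -> A) k m n :
  factor_at u k (m + n) = factor_at u k m ++ factor_at u (k + m) n.
Proof. by rewrite !factor_atE iotaD map_cat. Qed.

Lemma size_factor_at {A : Type} (u : nat -> A) k n : size (factor_at u k n) = n.
Proof. exact: size_mkseq. Qed.

Lemma factor_at_catl {A : Type} {u : nat -> A} {p q k} :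
  p ++ q = factor_at u k (size (p ++ q)) -> p = factor_at u k (size p).
Proof.
rewrite size_cat factor_atD => /(congr1 (take (size p))).
by rewrite take_size_cat // take_size_cat // size_factor_at.
Qed.

Lemma factor_at_catr {A : Type} {u : nat -> A} {p q k} :
  p ++ q = factor_at u k (size (p ++ q)) ->
  q = factor_at u (k + size p) (size q).
Proof.
rewrite size_cat factor_atD => /(congr1 (drop (size p))).
by rewrite drop_size_cat // drop_size_cat // size_factor_at.
Qed.

(** The first [m + n] blocks form a prefix of [v]; cutting off the first [m] leaves [b]. *)
Lemma concat_word_blocks {A : Type} {x : nat -> seq A} {v} m n :
  concat_word x v ->
  let b := flatten (map x (iota m n)) in
  b = factor_at v (size (flatten (mkseq x m))) (size b).
Proof.
case=> /(_ (m + n)) /= + _; rewrite {1 2}/mkseq iotaD map_cat flatten_cat.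
exact: factor_at_catr.
Qed.

Lemma champernowne_factor {A : Type} {u : nat -> A} w :
  champernowne u -> factor w u.
Proof.
case=> x [y _ yK] xu; exists (size (flatten (mkseq x (y w)))).
by have := concat_word_blocks (y w) 1 xu; rewrite /= yK cats0.
Qed.

(** Bézout's identity multiplied by [t], its negative coefficient made natural modulo [k]. *)
Lemma coprime_combination a b k t :
  coprime a b -> 0 < k -> exists m n, m * a + n * b = t %[mod k].
Proof.
case: a => [|a]; first by rewrite /coprime gcd0n => /eqP -> _; exists 0, t; rewrite muln1.
case: k => // k /eqP co _; case: (egcdnP b (ltn0Sn a)) => c d cd _.
(* The modulus is now [k.+1], so the factor [k] acts as -1. *)
exists (t * c), (t * d * k).
rewrite -mulnA cd co.
suff -> : t * (d * b + 1) + t * d * k * b = (t * d * b) * k.+1 + t by rewrite modnMDl.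
by rewrite mulnDr muln1 mulnS mulnA addnAC -!mulnA (mulnC k b).
Qed.

Section Morphism.

Variables (A : Type) (sigma : seq A -> seq A).
Hypothesis sigma_morphism : word_morphism sigma.

Lemma morphism_flatten ss : sigma (flatten ss) = flatten (map sigma ss).
Proof.
by case: sigma_morphism => s0 sD; elim: ss => //= s ss IH; rewrite sD IH.
Qed.

Lemma morphism_map (u : nat -> A) (e : seq nat) :
  flatten (map (fun n => sigma [:: u n]) e) = sigma (map u e).
Proof.
case: sigma_morphism => s0 sD; elim: e => //= n e ->.
by rewrite -sD.
Qed.

Lemma size_morphism_power n s :
  size (sigma (flatten (nseq n s))) = n * size (sigma s).
Proof.
by rewrite morphism_flatten map_nseq size_flatten /shape map_nseq sumn_nseq mulnC.
Qed.

Lemma morphism_factor {u v : nat -> A} {z} :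
  concat_word (fun n => sigma [:: u n]) v -> factor z u -> factor (sigma z) v.
Proof.
move=> uv [k zE]; have := concat_word_blocks k (size z) uv.
rewrite morphism_map -factor_atE -zE => E.
by exists (size (flatten (mkseq (fun n => sigma [:: u n]) k))).
Qed.

(** Images of prefixes of [u] are unboundedly long, so one of them reaches past the end of an
    occurrence of [w]. *)
Lemma factor_morphism_prefix {u v : nat -> A} {w} :
  concat_word (fun n => sigma [:: u n]) v -> factor w v ->
  exists s p q, sigma s = p ++ w ++ q.
Proof.
case=> pre unb [c wE]; have [n le_n] := unb (c + size w).
exists (mkseq u n), (factor_at v 0 c).
have /= := pre n; rewrite -(subnKC le_n) factor_atD add0n factor_atD add0n -wE.
rewrite morphism_map -catA => ->; eexists; reflexivity.
Qed.

(** By Bézout, a suitable word of the form a^m b^n works. *)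
Lemma morphism_length_mod {a b : A} {k} t :
  coprime (size (sigma [:: a])) (size (sigma [:: b])) -> 0 < k ->
  exists r, size (sigma r) = t %[mod k].
Proof.
case: (sigma_morphism) => _ sD co k_gt0.
have [m [n mn]] := coprime_combination _ _ _ t co k_gt0.
exists (flatten (nseq m [:: a]) ++ flatten (nseq n [:: b])).
by rewrite sD size_cat !size_morphism_power.
Qed.

End Morphism.

Theorem theorem5p2 (A : finType) (hA : 0 < #|A|) (u : nat -> A) :
  champernowne u -> strongly_modulo_recurrent u.
Proof.
move=> chu sigma morph co v uv w wv k i k_gt0 lt_ik.
have [/card_le1_eqP A1 | /card_gt1P [a [b [_ _ /eqP ab]]]] := leqP #|A| 1.
  (* With a single letter, words of equal length coincide, so any position serves. *)
  exists 0; apply: (@eq_from_nth _ (v 0)); first by rewrite size_factor_at.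
  by move=> j _; apply: A1.
have [s [p [q sE]]] := factor_morphism_prefix _ _ morph uv wv.
(* The target is 1 - |sigma(s)| modulo [k], since [k.-1] acts as -1. *)
have [r rE] := morphism_length_mod _ _ morph (1 + size (sigma s) * k.-1) (co a b ab) k_gt0.
have [_ sD] := morph.
have srE : size (sigma (s ++ r)) = 1 %[mod k].
  rewrite sD size_cat -modnDmr rE modnDmr addnCA -mulnS.
  by rewrite prednK // addnC modnMDl.
have [N zE] := morphism_factor _ _ morph uv
  (champernowne_factor (flatten (nseq k (s ++ r))) chu).
(* [c] is where [w] occurs in the first copy of [sigma (s ++ r)]; each further copy shifts it by 1
   modulo [k]. *)
set c := N + size p.
(* [j] is [i - c] modulo [k], written without subtraction. *)
pose j := (i + c * k.-1) %% k.
have lt_jk : j < k by rewrite ltn_mod.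
have posE : c + j * size (sigma (s ++ r)) = i %[mod k].
  rewrite -modnDmr -modnMmr srE modnMmr muln1 modnDmr /j modnDmr.
  by rewrite addnCA -mulnS prednK // addnC modnMDl.
exists ((c + j * size (sigma (s ++ r))) %/ k).
have -> : k * ((c + j * size (sigma (s ++ r))) %/ k) + i =
          N + size (sigma (flatten (nseq j (s ++ r)))) + size p.
  rewrite -(modn_small lt_ik) -posE mulnC -divn_eq size_morphism_power //.
  by rewrite /c addnAC.
(* Split off [j] copies; the next one starts with [p ++ w], so peeling off the copies and [p]
   isolates [w]. *)
move: zE; rewrite -{1 2}(subnKC lt_jk) addSnnS nseqD flatten_cat sD /= !sD sE -!catA.
by move=> /factor_at_catr /factor_at_catr /factor_at_catl.
Qed.
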